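(* For $A\subseteq\mathbb N$, the following statements are equivalent: (1) there exist an infinite set $B\subseteq\mathbb N$ and $t\in\mathbb Z_+$ such that $B^{\oplus 2}\subseteq A-t$; (2) there exist nonprincipal ultrafilters $\mathfrak p$ and $\mathfrak q$ on $\mathbb N$ such that $\mathfrak p+\mathfrak q=\mathfrak q+\mathfrak p$ and $A\in\mathfrak p+\mathfrak q$.
   Context: $\mathbb N=\{1,2,\ldots\}$, $\mathbb Z_+=\{0,1,2,\ldots\}$. For $C\subseteq\mathbb N$ and $t\in\mathbb Z_+$, $C-t:=\{n\in\mathbb N:n+t\in C\}$. For $B\subseteq\mathbb N$, $B^{\oplus 2}:=\{\sum_{n\in F}n:F\subseteq B,\ |F|=2\}$ (sums of two distinct elements of $B$). Addition of ultrafilters on $\mathbb N$ is defined by $C\in\mathfrak r+\mathfrak s\iff\{n\in\mathbb N:C-n\in\mathfrak s\}\in\mathfrak r$. *)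

(* Defs.v *)
From mathcomp Require Import all_boot finmap.
From mathcomp Require Import mathcomp_extra boolp classical_sets functions.
From mathcomp Require Import cardinality filter.

Set Implicit Arguments.
Unset Strict Implicit.
Unset Printing Implicit Defensive.

Local Open Scope classical_set_scope.

(* [0] is excluded here, whereas translation amounts [t : nat] may be [0]. *)
Definition posnat : Type := {n : nat | (0 < n)%N}.

Fact posnat_addn_subproof (n : posnat) (t : nat) : (0 < val n + t)%N.
Proof. by rewrite ltn_addr // (valP n). Qed.

Definition posnat_addn (n : posnat) (t : nat) : posnat :=
  exist _ (val n + t)%N (posnat_addn_subproof n t).

Definition set_subn (C : set posnat) (t : nat) : set posnat :=
  [set n | C (posnat_addn n t)].

Definition sums2 (B : set posnat) : set posnat :=
  [set m : posnat | exists F : {fset posnat},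
    [/\ [set` F] `<=` B, #|` F|%fset = 2%N
      & val m = (\sum_(n <- F) val n)%N]].

Definition nonprincipal (p : set_system posnat) : Prop :=
  ~ exists n : posnat, p = principal_filter n.

Definition ultra_add (r s : set_system posnat) : set_system posnat :=
  [set C | r [set n | s (set_subn C (val n))]].

(* Main.v *)
(** For (1) => (2), take a nonprincipal ultrafilter [u] containing [B]; then
    [A - t] lies in [u + u], and [p = u + t], [q = u] commute.  Conversely, if
    [A - t] lies in [u + u], then every finite set whose pairwise sums lie in
    [A - t] and whose elements [n] satisfy [A - t - n] in [u] can be enlarged.
    For (2) => (1) it thus remains to find a translate of [A] in [p + p] or
    [q + q].  Suppose there is none.  Let [U] be the set of all [x = y + n] with
    [A - y] in [q] and [A - (y + j)] not in [p] for all [j <= n].  Then [U] lies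
    in [q + p], and the set [V] obtained by exchanging [p] and [q] lies in
    [p + q].  [U] and [V] are disjoint, contradicting [p + q = q + p].  (This is
    the argument showing that the closures of [N + p] and [N + q] in the
    Stone-Cech compactification meet only if one of these two sets meets the
    closure of the other.) *)
Require Import Defs.
From mathcomp Require Import all_boot finmap.
From mathcomp Require Import mathcomp_extra boolp classical_sets functions.
From mathcomp Require Import cardinality filter.

Set Implicit Arguments.
Unset Strict Implicit.
Unset Printing Implicit Defensive.

Local Open Scope classical_set_scope.

Lemma posnat_addnA (x : posnat) (s t : nat) :
  posnat_addn (posnat_addn x s) t = posnat_addn x (s + t).
Proof. by apply: val_inj; rewrite /= addnA. Qed.

Lemma set_subnD (C : set posnat) (s t : nat) :
  set_subn (set_subn C s) t = set_subn C (t + s).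
Proof.
by rewrite predeqE => x; rewrite /set_subn /= posnat_addnA.
Qed.

Lemma sums2_subP (B S : set posnat) :
  sums2 B `<=` S <->
  (forall x y, B x -> B y -> x != y -> S (posnat_addn x (val y))).
Proof.
split=> [BS x y Bx By xy|BS m [F [FB F2 mE]]].
  apply: BS; exists [fset x; y]%fset; split.
  - by move=> z /=; rewrite !inE => /orP[] /eqP->.
  - by rewrite cardfs2 xy.
  - have xyE : perm_eq (enum_fset [fset x; y]%fset) [:: x; y].
      apply: uniq_perm; rewrite ?fset_uniq //= ?inE ?xy //.
      by move=> z; rewrite !inE.
    by rewrite (perm_big _ xyE) !big_cons big_nil /= addn0.
have := fset_uniq F; have {FB} : forall z, z \in enum_fset F -> B z.
  by move=> z zF; exact: FB.
move: F2 mE; case: (enum_fset F) => [|x [|y [|? ?]]] //= _.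
rewrite !big_cons big_nil /= addn0 => mE FB; rewrite inE => /andP[xy _].
have -> : m = posnat_addn x (val y) by exact: val_inj.
by apply: BS => //; apply: FB; rewrite !inE eqxx ?orbT.
Qed.

Lemma filterI_ex {T : Type} (F : set_system T) {FF : ProperFilter F}
    (A B : set T) : F A -> F B -> exists x, A x /\ B x.
Proof. by move=> FA FB; exact: filter_ex (filterI FA FB). Qed.

Lemma ultra_setC {T : Type} (F : set_system T) {FU : UltraFilter F}
    (A : set T) :
  F (~` A) <-> ~ F A.
Proof.
split=> [FCA FA|]; last by case: (in_ultra_setVsetC A FU).
apply: (@filter_not_empty _ F _).
by rewrite -(setICr A); exact: filterI.
Qed.

Lemma ultra_fmap {T U : Type} (f : T -> U) (F : set_system T) :
  UltraFilter F -> UltraFilter (fmap f F).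
Proof.
move=> FU; have fP : ProperFilter (fmap f F) by exact: fmap_proper_filter.
split=> // G GP FG; rewrite eqEsubset; split=> // A GA.
case: (in_ultra_setVsetC (f @^-1` A) FU) => // FCA.
have /FG GCA : fmap f F (~` A) by [].
by case: (@filter_not_empty _ G _); rewrite -(setICr A); exact: filterI.
Qed.

Lemma nonprincipalP (p : set_system posnat) {pU : UltraFilter p} :
  nonprincipal p <-> forall n, p (~` [set n]).
Proof.
split=> [np n|pC [n pE]].
  apply/ultra_setC => pn; apply: np; exists n.
  apply: (@max_filter _ _ (principal_filter_ultra n)) => C.
  by move=> /principal_filterP Cn; apply: filterS pn => _ ->.
by have := pC n; rewrite pE => /principal_filterP; apply.
Qed.

(** The sets missing only finitely many elements of [B] form a proper filter because [B] is
    infinite. Any ultrafilter extending it works. *)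
Lemma infinite_nonprincipal_ultra (B : set posnat) : infinite_set B ->
  exists u : set_system posnat, [/\ UltraFilter u, nonprincipal u & u B].
Proof.
move=> Binf; pose F : set_system posnat := [set C | finite_set (B `\` C)].
have FP : ProperFilter F.
  split; first by rewrite /F /= setD0.
  split; first by rewrite /F /= setDT; exact: finite_set0.
    by move=> C D FC FD; rewrite /F /= setDIr finite_setU.
  move=> C D CD; apply: sub_finite_set => x [Bx nDx].
  by split=> // /CD.
have [u [uU Fu]] := ultraFilterLemma FP.
exists u; split=> //; last first.
  by apply: Fu; rewrite /F /= setDv; exact: finite_set0.
apply/nonprincipalP => n; apply: Fu; apply: sub_finite_set (finite_set1 n).
by move=> x [_ /contrapT].
Qed.

(** Zorn's lemma replaces a recursive construction: a maximal admissible [B] cannot be finite, since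
    a finite one can be enlarged. *)
Lemma ultra_add_self_sums2 (u : set_system posnat) (S : set posnat) :
  UltraFilter u -> nonprincipal u -> ultra_add u u S ->
  exists B, infinite_set B /\ sums2 B `<=` S.
Proof.
move=> uU /nonprincipalP uC uS.
pose G := [set n : posnat | u (set_subn S (val n))].
pose P := [set B : set posnat | B `<=` G /\ sums2 B `<=` S].
have [F FP Ftot|B [[BG /sums2_subP BS] Bmax]] := @Zorn_bigcup _ P.
  split=> [x [X /FP[XG _]]|]; first exact: XG.
  apply/sums2_subP => x y [X FX Xx] [Y FY Yy].
  have [_ /sums2_subP XS] := FP _ FX; have [_ /sums2_subP YS] := FP _ FY.
  by case: (Ftot X Y FX FY) => XY; [apply: YS|apply: XS] => //; exact: XY.
exists B; split; last exact/sums2_subP.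
move=> /finite_fsetP[X BE].
(* Removing [b] makes any point common to all [f b] a new element. *)
pose f (b : posnat) := set_subn S (val b) `&` ~` [set b].
have uX : u (\bigcap_(b in [set` X]) f b).
  apply: filter_bigI => b bX; apply: filterI; last exact: uC.
  by apply: BG; rewrite BE.
have [x [Gx fx]] := filterI_ex (F := u) uS uX.
have xB : ~ B x by move=> Bx; move: (Bx); rewrite BE => /fx[_]; apply.
have BSx b : B b -> S (posnat_addn x (val b)) by rewrite BE => /fx[].
apply: (Bmax (x |` B)).
  split=> [b Bb|xBB]; first by right.
  by apply: xB; apply: xBB; left.
split=> [y [->|/BG]//|].
apply/sums2_subP => y z [->|By] [->|Bz]; rewrite ?eqxx // => yz.
- exact: BSx.
- have -> : posnat_addn y (val x) = posnat_addn x (val y).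
    by apply: val_inj; rewrite /= addnC.
  exact: BSx.
- exact: BS.
Qed.

Lemma commuting_ultra_add_self (p q : set_system posnat) (A : set posnat) :
  UltraFilter p -> UltraFilter q ->
  ultra_add p q = ultra_add q p -> ultra_add p q A ->
  exists t, ultra_add p p (set_subn A t) \/ ultra_add q q (set_subn A t).
Proof.
move=> pU qU pqE pqA; apply: contrapT => nex.
pose U (r s : set_system posnat) := [set x |
  exists (n : nat) (y : posnat), [/\ x = posnat_addn y n,
  s (set_subn A (val y)) &
  forall j, (j <= n)%N -> ~ r (set_subn A (val y + j))]].
(* If [y + n = z + k] with [k <= n], then [z = y + (n - k)], so the ban on [p] at [y + j] for
   [j <= n] hits [z]. The other case is symmetric. *)
have UV x : U p q x -> U q p x -> False.
  move=> [n [y [-> qy npy]]] [k [z [yzE pz nqz]]].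
  have {}yzE : (val y + n = val z + k)%N by case: yzE.
  have [kn|/ltnW nk] := leqP k n.
    apply: (npy (n - k)%N); first exact: leq_subr.
    by rewrite (_ : _ + _ = val z)%N // addnBA // yzE addnK.
  apply: (nqz (k - n)%N); first exact: leq_subr.
  by rewrite (_ : _ + _ = val y)%N // addnBA // -yzE addnK.
have addU r s : UltraFilter r -> UltraFilter s ->
    (forall t, ~ ultra_add r r (set_subn A t)) ->
    ultra_add r s A -> ultra_add s r (U r s).
  move=> rU sU nrr rsA.
  (* For fixed [n] only the finitely many conditions [j <= n] arise. Each holds [r]-almost
     everywhere, as [A - j] is not in [r + r]. *)
  have rn n : r (set_subn (U r s) n).
    pose D (j : 'I_n.+1) := [set y : posnat | ~ r (set_subn A (val y + j))].
    have rD : r (\bigcap_(j in [set` [fset j | j : 'I_n.+1]%fset]) D j).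
      apply: filter_bigI => j _; apply/ultra_setC => rj; apply: (nrr j).
      by apply: (@filterS _ r _ _ _ _ rj) => y /=; rewrite set_subnD.
    have rA : r [set y | s (set_subn A (val y))] by [].
    apply: filterS (filterI rA rD) => y [sy Dy].
    exists n, y; split=> // j jn.
    by apply: (Dy (Ordinal (jn : (j < n.+1)%N))); rewrite /= !inE.
  by apply: (@filterS _ s _ setT) filterT => n _; exact: rn.
have qpU : ultra_add q p (U p q).
  by apply: addU => // t pt; apply: nex; exists t; left.
have : ultra_add p q (U q p).
  by apply: addU; rewrite -?pqE // => t qt; apply: nex; exists t; right.
rewrite pqE => qpV.
have [n [pUn pVn]] := filterI_ex (F := q) qpU qpV.
by have [x [/UV]] := filterI_ex pUn pVn.
Qed.

Theorem theorem1p3 (A : set posnat) :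
  (exists (B : set posnat) (t : nat),
      infinite_set B /\ sums2 B `<=` set_subn A t)
  <->
  (exists p q : set_system posnat,
      [/\ UltraFilter p /\ nonprincipal p,
          UltraFilter q /\ nonprincipal q,
          ultra_add p q = ultra_add q p
        & ultra_add p q A]).
Proof.
split=> [[B [t [/infinite_nonprincipal_ultra[u [uU uN uB]] /sums2_subP BA]]]|].
  have uC : forall n, u (~` [set n]) by exact/nonprincipalP.
  pose p := fmap (posnat_addn^~ t) u.
  have pU : UltraFilter p by exact: ultra_fmap.
  exists p, u; split=> //.
  (* Translation by [t] is injective, so the preimage of a point cannot contain two elements [m] and
     [k]. *)
  - split=> //; apply/nonprincipalP => n; apply/ultra_setC => pn.
    have [m [mn _]] := filterI_ex (F := u) pn pn.
    have [k [kn km]] := filterI_ex (F := u) pn (uC m).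
    apply: km; apply: val_inj; apply: (@addIn t).
    by rewrite -[RHS]/(val (posnat_addn m t)) mn -kn.
  - rewrite predeqE => C; rewrite /ultra_add /p /fmap /=.
    have E n : set_subn (set_subn C (val n)) t = set_subn C (val n + t).
      by rewrite set_subnD addnC.
    by split; apply: filterS => n /=; rewrite -?E.
  (* Only sums of distinct elements are controlled, so [n] is removed from [B] before [m] is
     taken. *)
  - apply: (@filterS _ u _ _ _ _ uB) => n Bn.
    apply: filterS (filterI uB (uC n)) => m [Bm /eqP mn].
    have := BA m n Bm Bn mn.
    by rewrite /set_subn /= posnat_addnA.
move=> [p [q [[pU pN] [qU qN] pqE pqA]]].
have [t [tp|tq]] := commuting_ultra_add_self pU qU pqE pqA.
- by have [B ?] := ultra_add_self_sums2 pU pN tp; exists B, t.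
- by have [B ?] := ultra_add_self_sums2 qU qN tq; exists B, t.
Qed.
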